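(* Let $K$ be an infinite field of characteristic $p>2$ and let $W_1$ be the first Weyl algebra over $K$ with its $\mathbb{Z}_p$-grading. Then the ideal $T_{\mathbb{Z}_p}(W_1)$ of $\mathbb{Z}_p$-graded identities of $W_1$ is generated, as a graded T-ideal, by the identities $$z_1^0z_2^0=z_2^0z_1^0,\qquad z_1^{\alpha}z_2^{-\alpha}z_3^{\alpha}=z_3^{\alpha}z_2^{-\alpha}z_1^{\alpha}\quad(\alpha\in\mathbb{Z}_p),$$ where $z_i^{\beta}$ denotes a variable of degree $\beta\in\mathbb{Z}_p$ (superscripts are degrees, not powers).
   Context: $W_1$ is the unital associative $K$-algebra generated by $x,y$ subject to $yx-xy=1$. $\mathbb{Z}_p$ is the cyclic group of order $p$. The $\mathbb{Z}_p$-grading on $W_1$ is $W_1=\bigoplus_{k=0}^{p-1}A_k$, where $A_k$ is the $K$-span of all $x^ry^s$ ($r,s\ge 0$) with $r-s\equiv k\pmod p$. For a group $G$, $K\langle X\mid G\rangle$ denotes the free unital associative algebra on $X=\bigcup_{g\in G}X_g$ (disjoint union of countably infinite sets), graded by giving the variables of $X_g$ degree $g$. For a $G$-graded algebra $A$, $f\in K\langle X\mid G\rangle$ is a graded identity of $A$ if $f$ vanishes under every substitution of each variable by a homogeneous element of $A$ of the same degree; $T_G(A)$ is the ideal of all graded identities. An identity $f=g$ means that $f-g$ is a graded identity. A graded T-ideal is an ideal of $K\langle X\mid G\rangle$ closed under all graded endomorphisms; the graded T-ideal generated by a set is the smallest one containing it. *)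

(* Defs.v *)
From HB Require Import structures.
From mathcomp Require Import all_boot all_algebra.
From mathcomp Require Import boolp classical_sets cardinality.
From mathcomp Require Import finmap.
From mathcomp.multinomials Require Import monalg.

Set Implicit Arguments.
Unset Strict Implicit.
Unset Printing Implicit Defensive.

Import GRing.Theory.
Local Open Scope ring_scope.
Local Open Scope classical_set_scope.

Definition two_sided_ideal (R : pzRingType) (I : set R) : Prop :=
  [/\ I 0, forall a b, I a -> I b -> I (a - b)
    & forall r a, I a -> I (r * a) /\ I (a * r)].

Definition lspan (K : pzRingType) (V : lmodType K) (S : set V) : set V :=
  [set v | exists n (c : 'I_n -> K) (b : 'I_n -> V),
     (forall i, S (b i)) /\ v = \sum_i c i *: b i].

Lemma smallest_two_sided_ideal (R : pzRingType) (S : set R) :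
  two_sided_ideal (smallest (@two_sided_ideal R) S).
Proof.
split=> [I [[I0 _ _] _] //|a b Ia Ib I [idI SI]|r a Ia].
  by have [_ + _] := idI; apply; [apply: Ia|apply: Ib].
by split=> I [idI SI]; have [_ _ /(_ r a)[|//]] := idI; apply: Ia.
Qed.

(* The free unital associative algebra on V: words over V form the free
   monoid {fmonom V}, of which this is the monoid algebra. *)
Definition freealg (K : fieldType) (V : choiceType) := {malg K[{fmonom V}]}.

HB.instance Definition _ (K : fieldType) (V : choiceType) := GRing.Lalgebra.on (freealg K V).

Lemma malg_scalerAr (K : fieldType) (M : monomType) c (f g : {malg K[M]}) :
  c *: (f * g) = f * (c *: g).
Proof.
apply/malgP => w; rewrite mcoeffZ mcoeffMl.
rewrite (mcoeffMlw _ (fsubset_refl _) (msuppZ_le c g)) mulr_sumr.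
apply: eq_bigr => u _; rewrite mulr_sumr; apply: eq_bigr => v _.
by rewrite mcoeffZ mulrnAr mulrCA.
Qed.

HB.instance Definition _ (K : fieldType) (V : choiceType) :=
  GRing.Lalgebra_isAlgebra.Build K (freealg K V)
    (@malg_scalerAr K {fmonom V}).

Definition fvar (K : fieldType) (V : choiceType) (v : V) : freealg K V :=
  << fmu v >>.

Definition fsubst (K : fieldType) (V : choiceType) (A : algType K)
    (s : V -> A) : freealg K V -> A :=
  mmap (in_alg A) (fun w : {fmonom V} => \prod_(v <- w) s v).

Section Weyl.
Variable K : fieldType.

(* The free generators x and y are indexed by false and true. *)
Local Notation free2 := (freealg K bool).
Local Notation X := (fvar K false).
Local Notation Y := (fvar K true).

Definition weyl_ideal : set free2 :=
  smallest (@two_sided_ideal free2) [set Y * X - X * Y - 1].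

Definition weyl_ideal_pred : {pred free2} := fun f => `[< weyl_ideal f >].

Lemma weyl_idealP : two_sided_ideal weyl_ideal.
Proof. exact: smallest_two_sided_ideal. Qed.

Lemma weyl_ideal_zmod_closed : zmod_closed weyl_ideal_pred.
Proof.
have [I0 IB _] := weyl_idealP.
by split=> [|f g /asboolP If /asboolP Ig]; apply/asboolP => //; apply: IB.
Qed.

HB.instance Definition _ :=
  GRing.isZmodClosed.Build free2 weyl_ideal_pred weyl_ideal_zmod_closed.

Definition weyl := {ideal_quot weyl_ideal_pred}.

HB.instance Definition _ := GRing.Zmodule.on weyl.

Definition weyl_pi : free2 -> weyl := \pi_weyl%qT.

Lemma weyl_piP (f g : free2) : weyl_pi f = weyl_pi g <-> weyl_ideal (f - g).
Proof.
split=> [/eqP|I].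
  by rewrite /weyl_pi -Quotient.idealrBE => /asboolP.
by apply/eqP; rewrite /weyl_pi -Quotient.idealrBE; apply/asboolP.
Qed.

Lemma weyl_reprK : cancel (repr : weyl -> free2) weyl_pi.
Proof. by move=> a; apply: reprK. Qed.

Lemma weyl_pi_ind (P : weyl -> Prop) : (forall f, P (weyl_pi f)) -> forall a, P a.
Proof. by move=> Pf a; rewrite -(weyl_reprK a). Qed.

Lemma weyl_pi_zmod_morphism : zmod_morphism weyl_pi.
Proof. by move=> f g; rewrite /weyl_pi raddfB. Qed.

HB.instance Definition _ :=
  GRing.isZmodMorphism.Build free2 weyl weyl_pi weyl_pi_zmod_morphism.

Definition weyl_mul (a b : weyl) : weyl := weyl_pi (repr a * repr b).
Definition weyl_scale (c : K) (a : weyl) : weyl := weyl_pi (c *: repr a).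

Lemma weyl_piM f g : weyl_mul (weyl_pi f) (weyl_pi g) = weyl_pi (f * g).
Proof.
have [_ IB IM] := weyl_idealP; apply/weyl_piP.
have If h : weyl_ideal (repr (weyl_pi h) - h).
  by apply/weyl_piP; rewrite weyl_reprK.
set f' := repr _; set g' := repr _.
have -> : f' * g' - f * g = (f' - f) * g' - f * (g - g').
  by rewrite mulrBl mulrBr opprB addrA subrK.
apply: IB; first exact: (IM g' _ (If f)).2.
rewrite -opprB mulrN -mulNr.
exact: (IM (- f) _ (If g)).1.
Qed.

Lemma weyl_piZ c f : weyl_scale c (weyl_pi f) = weyl_pi (c *: f).
Proof.
apply/weyl_piP; rewrite -scalerBr -mulr_algl.
have [_ _ IM] := weyl_idealP; apply: (IM c%:A _ _).1.
by apply/weyl_piP; rewrite weyl_reprK.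
Qed.

(* Non-triviality of the quotient: x acts on {poly K} as multiplication by 'X
   and y as the derivation d/d'X. *)
Definition weyl_letter (b : bool) (q : {poly K}) : {poly K} :=
  if b then q^`() else 'X * q.

Definition weyl_act (f : free2) (q : {poly K}) : {poly K} :=
  mmap (@polyC K) (fun w : {fmonom bool} => foldr weyl_letter q w) f.

Lemma weyl_word_linear (w : seq bool) c (q r : {poly K}) :
  foldr weyl_letter (c%:P * q + r) w =
  c%:P * foldr weyl_letter q w + foldr weyl_letter r w.
Proof.
elim: w => //= b w ->; case: b => /=; last by rewrite mulrDr mulrCA.
by rewrite derivD mul_polyC derivZ -mul_polyC.
Qed.

Lemma weyl_wordD (w : seq bool) (q r : {poly K}) :
  foldr weyl_letter (q + r) w = foldr weyl_letter q w + foldr weyl_letter r w.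
Proof. by have := weyl_word_linear w 1 q r; rewrite !mul1r. Qed.

Lemma weyl_word0 (w : seq bool) : foldr weyl_letter 0 w = 0.
Proof. by apply: (addrI (foldr weyl_letter 0 w)); rewrite -weyl_wordD !addr0. Qed.

Lemma weyl_wordZ (w : seq bool) c (q : {poly K}) :
  foldr weyl_letter (c%:P * q) w = c%:P * foldr weyl_letter q w.
Proof. by have := weyl_word_linear w c q 0; rewrite weyl_word0 !addr0. Qed.

Lemma weyl_actU c w q :
  weyl_act << c *g w >> q = c%:P * foldr weyl_letter q (w : {fmonom bool}).
Proof. exact: mmapU. Qed.

Lemma weyl_actV b q : weyl_act (fvar K b) q = weyl_letter b q.
Proof. by rewrite weyl_actU fmU mul1r. Qed.

Lemma weyl_act1 q : weyl_act 1 q = q.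
Proof. by rewrite weyl_actU fm1 mul1r. Qed.

Lemma weyl_actB f g q : weyl_act (f - g) q = weyl_act f q - weyl_act g q.
Proof. exact: raddfB. Qed.

Lemma weyl_act_sum (T : Type) (s : seq T) (F : T -> free2) q :
  weyl_act (\sum_(i <- s) F i) q = \sum_(i <- s) weyl_act (F i) q.
Proof. exact: raddf_sum. Qed.

Lemma weyl_actM f g q : weyl_act (f * g) q = weyl_act f (weyl_act g q).
Proof.
rewrite malgME weyl_act_sum [RHS]mmapE; apply: eq_bigr => u _.
rewrite weyl_act_sum {2}/weyl_act mmapE.
rewrite (big_morph (fun r => foldr weyl_letter r u) (weyl_wordD u)
  (weyl_word0 u)) mulr_sumr; apply: eq_bigr => v _.
by rewrite weyl_actU weyl_wordZ fmM foldr_cat polyCM mulrA.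
Qed.

Lemma weyl_act0 f : weyl_act f 0 = 0.
Proof.
by rewrite /weyl_act mmapE big1 // => w _; rewrite weyl_word0 mulr0.
Qed.

Lemma weyl_ideal_act f q : weyl_ideal f -> weyl_act f q = 0.
Proof.
suff : weyl_ideal `<=` [set f | forall q, weyl_act f q = 0] by move=> /[apply].
apply: smallest_sub => [|_ -> {}q].
  split=> [r|g h Ig Ih r|g h Ih] /=; first exact: raddf0.
    by rewrite weyl_actB Ig Ih subrr.
  by split=> r; rewrite weyl_actM Ih // weyl_act0.
have lettersM b c : weyl_act (fvar K b * fvar K c) q =
    weyl_letter b (weyl_letter c q).
  by rewrite weyl_actM !weyl_actV.
apply: etrans (weyl_actB _ _ _) _.
apply: etrans (congr2 _ (weyl_actB _ _ _) (congr1 _ (weyl_act1 _))) _.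
apply: etrans (congr2 _ (congr2 _ (lettersM _ _) (congr1 _ (lettersM _ _))) erefl) _.
rewrite /=.
by rewrite derivM derivX mul1r addrK subrr.
Qed.

Let weyl_one : weyl := weyl_pi 1.

Lemma weyl_mulA : associative weyl_mul.
Proof.
by elim/weyl_pi_ind=> f; elim/weyl_pi_ind=> g; elim/weyl_pi_ind=> h;
  rewrite !weyl_piM mulrA.
Qed.

Lemma weyl_mul1 : left_id weyl_one weyl_mul.
Proof. by elim/weyl_pi_ind=> f; rewrite weyl_piM mul1r. Qed.

Lemma weyl_1mul : right_id weyl_one weyl_mul.
Proof. by elim/weyl_pi_ind=> f; rewrite weyl_piM mulr1. Qed.

Lemma weyl_mulDl : left_distributive weyl_mul +%R.
Proof.
by elim/weyl_pi_ind=> f; elim/weyl_pi_ind=> g; elim/weyl_pi_ind=> h;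
  rewrite -raddfD !weyl_piM mulrDl raddfD.
Qed.

Lemma weyl_mulDr : right_distributive weyl_mul +%R.
Proof.
by elim/weyl_pi_ind=> f; elim/weyl_pi_ind=> g; elim/weyl_pi_ind=> h;
  rewrite -raddfD !weyl_piM mulrDr raddfD.
Qed.

Lemma weyl_one_neq0 : weyl_one != 0.
Proof.
apply/eqP; rewrite /weyl_one -[0](raddf0 weyl_pi) => /weyl_piP.
move=> /(@weyl_ideal_act _ 1); rewrite subr0 weyl_act1.
by move/eqP; rewrite oner_eq0.
Qed.

HB.instance Definition _ := GRing.Zmodule_isNzRing.Build weyl
  weyl_mulA weyl_mul1 weyl_1mul weyl_mulDl weyl_mulDr weyl_one_neq0.

Lemma weyl_scaleA a b (u : weyl) :
  weyl_scale a (weyl_scale b u) = weyl_scale (a * b) u.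
Proof. by elim/weyl_pi_ind: u => f; rewrite !weyl_piZ scalerA. Qed.

Lemma weyl_scale1 : left_id 1 weyl_scale.
Proof. by elim/weyl_pi_ind=> f; rewrite weyl_piZ scale1r. Qed.

Lemma weyl_scaleDr : right_distributive weyl_scale +%R.
Proof.
by move=> c; elim/weyl_pi_ind=> f; elim/weyl_pi_ind=> g;
  rewrite -raddfD !weyl_piZ scalerDr raddfD.
Qed.

Lemma weyl_scaleDl (u : weyl) : {morph weyl_scale^~ u : a b / a + b}.
Proof.
by elim/weyl_pi_ind: u => f a b; rewrite !weyl_piZ scalerDl raddfD.
Qed.

HB.instance Definition _ := GRing.Zmodule_isLmodule.Build K weyl
  weyl_scaleA weyl_scale1 weyl_scaleDr weyl_scaleDl.

Lemma weyl_scaleAl c (u v : weyl) : c *: (u * v) = (c *: u) * v.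
Proof.
elim/weyl_pi_ind: u => f; elim/weyl_pi_ind: v => g.
by rewrite /GRing.mul /GRing.scale /= !(weyl_piM, weyl_piZ) scalerAl.
Qed.

HB.instance Definition _ := GRing.Lmodule_isLalgebra.Build K weyl weyl_scaleAl.

Lemma weyl_scaleAr c (u v : weyl) : c *: (u * v) = u * (c *: v).
Proof.
elim/weyl_pi_ind: u => f; elim/weyl_pi_ind: v => g.
by rewrite /GRing.mul /GRing.scale /= !(weyl_piM, weyl_piZ) scalerAr.
Qed.

HB.instance Definition _ := GRing.Lalgebra_isAlgebra.Build K weyl weyl_scaleAr.

Lemma weyl_pi_monoid_morphism : monoid_morphism weyl_pi.
Proof. by split=> [|f g]; [exact: erefl|exact/esym/weyl_piM]. Qed.

HB.instance Definition _ :=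
  GRing.isMonoidMorphism.Build free2 weyl weyl_pi weyl_pi_monoid_morphism.

Lemma weyl_pi_scalable : scalable weyl_pi.
Proof. by move=> c f; rewrite -weyl_piZ. Qed.

HB.instance Definition _ :=
  GRing.isScalable.Build K free2 weyl *:%R weyl_pi weyl_pi_scalable.

Definition weyl_x : weyl := weyl_pi X.
Definition weyl_y : weyl := weyl_pi Y.

Lemma weyl_comm : weyl_y * weyl_x - weyl_x * weyl_y = 1.
Proof.
rewrite -!rmorphM -raddfB -(rmorph1 weyl_pi); apply/weyl_piP.
exact: sub_gen_smallest.
Qed.

Definition weyl_grading (p : nat) (k : 'Z_p) : set weyl :=
  lspan [set a | exists r s : nat,
    r%:R - s%:R = k :> 'Z_p /\ a = weyl_x ^+ r * weyl_y ^+ s].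

End Weyl.

Section GradedIdentities.
Variables (K : fieldType) (G : zmodType).

(* K<X | G>: the variable (g, i) is the i-th element of X_g. The grading
   group is written additively, hence abelian. *)
Definition gfreealg := freealg K (G * nat)%type.

HB.instance Definition _ := GRing.Algebra.on gfreealg.

Definition gvar (g : G) (i : nat) : gfreealg := fvar K (g, i).

Definition word_degree (w : {fmonom (G * nat)%type}) : G := \sum_(v <- w) v.1.

Definition gfree_grading (g : G) : set gfreealg :=
  [set f | forall w, w \in msupp f -> word_degree w = g].

Definition graded_identities (A : algType K) (A_ : G -> set A) :
    set gfreealg :=
  [set f | forall s : (G * nat)%type -> A,
     (forall v, A_ v.1 (s v)) -> fsubst s f = 0].

Definition graded_endo (phi : gfreealg -> gfreealg) : Prop :=
  forall g f, gfree_grading g f -> gfree_grading g (phi f).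

Definition graded_T_ideal (I : set gfreealg) : Prop :=
  two_sided_ideal I /\
  forall phi : {lrmorphism gfreealg -> gfreealg},
    graded_endo phi -> forall f, I f -> I (phi f).

Definition graded_T_ideal_generated (S : set gfreealg) : set gfreealg :=
  smallest graded_T_ideal S.

End GradedIdentities.

Arguments gvar K {G} g i.
Arguments weyl_grading K p k : clear implicits.

(* Main.v *)
Require Import Defs.
From HB Require Import structures.
From mathcomp Require Import all_boot all_algebra.
From mathcomp Require Import boolp classical_sets cardinality.
From mathcomp Require Import finmap.
From mathcomp.multinomials Require Import monalg.

Set Implicit Arguments.
Unset Strict Implicit.
Unset Printing Implicit Defensive.

Import GRing.Theory.
Local Open Scope ring_scope.
Local Open Scope classical_set_scope.

(** The argument compares the free algebra with walks on the vertex set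
    [Z_p]. A letter of degree [g] read at the vertex [i] is a step from [i] to
    [i + g], so a word read from a vertex becomes a walk; [steps] lists its
    steps, and only the multiset of these steps will matter.

    The listed identities hold in [W_1]. With [t = x y], one has
    [x q(t) = q(t - 1) x] and [y q(t) = q(t + 1) y], so every monomial
    [x^r y^s] is [q(t) l^m] with [l] one of [x], [y]. In characteristic [p] the
    shift caused by [l^m] depends on the degree modulo [p] only, and the powers
    of [x], [y] of degree [0] are central. In [a b c] with degrees [alpha],
    [- alpha], [alpha] the coefficients [q(t)] can thus be collected on the left
    in any order, and two of the three powers [l^m] involve the same
    generator, which makes the product symmetric ([homogeneous_triple]).
    The commutation of degree [0] is the case [alpha = 0], [b = 1].

    Conversely, let [I] be a graded T-ideal with the triple identities. If two
    words have the same multiset of steps, they agree modulo [I]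
    ([perm_steps_T_ideal]): such words are two Eulerian trails of one directed
    multigraph, and exchanging two segments of a trail with common end points,
    separated by a segment going back, is an instance of [a b c = c b a];
    these exchanges bring the first step of the one trail to the front of the
    other ([bring_step_first]).

    It remains to see that a graded identity [f] of [W_1] has coefficient sum
    [0] on each class of words with equal multisets of steps. For this, [W_1]
    acts on the functions [Z_p -> K] by [x u (i) = u (i + 1)] and
    [y u (i) = - i u (i - 1)]. Since [y^(p-1)] acts with rank one, degree [g]
    contains elements acting as [u |-> (i |-> xi(i) u(i + g))] for any weights
    [xi] ([generic_elementE]). Evaluating [f] on such elements gives
    [sum_w f_w prod_(t in steps w) xi(t) = 0] for all weights [xi] on the set of
    steps ([graded_identity_steps]). As [K] is infinite, this polynomial
    in the [xi(t)] is zero, which is read off from a univariate polynomial by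
    the Kronecker substitution [xi(t) = z^(N^index(t))] ([steps_class_sum0]). *)

(** * Substitution in the free algebra *)

Section Substitution.
Variables (K : fieldType) (V : choiceType) (A : algType K).

Definition word_eval (s : V -> A) (w : {fmonom V}) : A := \prod_(v <- w) s v.

Lemma word_eval_mmorphism s : mmorphism (word_eval s).
Proof.
by split=> [u w|]; rewrite /word_eval ?fmM ?big_cat // fm1 big_nil.
Qed.

HB.instance Definition _ s :=
  monalg.isMultiplicative.Build {fmonom V} A (word_eval s)
    (word_eval_mmorphism s).

Lemma fsubst_zmod_morphism s : zmod_morphism (@fsubst K V A s).
Proof. by move=> f g; apply: mmapB. Qed.

Lemma fsubst_monoid_morphism s : monoid_morphism (@fsubst K V A s).
Proof.
have comm_alg (f : freealg K V) (u w : {fmonom V}) :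
    GRing.comm (in_alg A f@_u) (word_eval s w).
  by rewrite /GRing.comm /= -scalerAl mul1r -scalerAr mulr1.
have [morM mor1] := commr_mmap_is_multiplicative comm_alg.
by split=> [|f g]; [exact: mor1 | exact: morM].
Qed.

Lemma fsubst_scalable s : scalable (@fsubst K V A s).
Proof. by move=> c f; rewrite /fsubst (@mmapZ _ _ _ _ (word_eval s)) mulr_algl. Qed.

HB.instance Definition _ s :=
  GRing.isZmodMorphism.Build (freealg K V) A (fsubst s)
    (fsubst_zmod_morphism s).
HB.instance Definition _ s :=
  GRing.isMonoidMorphism.Build (freealg K V) A (fsubst s)
    (fsubst_monoid_morphism s).
HB.instance Definition _ s :=
  GRing.isScalable.Build K (freealg K V) A *:%R (fsubst s) (fsubst_scalable s).

Lemma fsubstE s (f : freealg K V) :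
  fsubst s f = \sum_(w <- msupp f) f@_w *: word_eval s w.
Proof.
by rewrite /fsubst mmapE; apply: eq_bigr => w _; rewrite /= mulr_algl.
Qed.

Lemma fsubst_word s w : fsubst s (<< w >> : freealg K V) = word_eval s w.
Proof. by rewrite /fsubst mmapU /= scale1r mul1r. Qed.

Lemma fsubst_var (s : V -> A) v : fsubst s (fvar K v) = s v.
Proof. by rewrite fsubst_word /word_eval fmU big_seq1. Qed.

Lemma eq_fsubst s t : s =1 t -> @fsubst K V A s =1 fsubst t.
Proof. by move=> /funext ->. Qed.

End Substitution.

Section FreeAlgebra.
Variables (K : fieldType) (V : choiceType).

Lemma word_prod (w : {fmonom V}) :
  (<< w >> : freealg K V) = word_eval (@fvar K V) w.
Proof.
case: w => w; rewrite /word_eval /=; elim: w => [|v w IHw].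
  by rewrite big_nil -[RHS]/(<< _ >>) /mone /= fmoneE.
rewrite big_cons -IHw; apply: esym; rewrite /fvar.
have -> : (fmu v : {fmonom V}) = FMonom [:: v] by exact: fmuE.
rewrite [LHS]fgmulUU mulr1; congr (<< _ *g _ >>).
by rewrite /mmul /= fmmulE.
Qed.

Lemma freealg_expand (f : freealg K V) :
  f = \sum_(w <- msupp f) f@_w *: (<< w >> : freealg K V).
Proof.
rewrite {1}[f]monalgE; apply: eq_bigr => w _.
by apply/malgP => u; rewrite mcoeffZ !mcoeffU mulr_natr.
Qed.

Lemma lrmorph_fsubst (A : algType K) (phi : {lrmorphism freealg K V -> A}) :
  phi =1 fsubst (phi \o @fvar K V).
Proof.
move=> f; rewrite fsubstE {1}[f]freealg_expand raddf_sum /=.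
by apply: eq_bigr => w _; rewrite linearZ word_prod rmorph_prod.
Qed.

End FreeAlgebra.

Lemma lrmorph_comp_fsubst (K : fieldType) (V : choiceType) (A B : algType K)
    (phi : {lrmorphism A -> B}) (s : V -> A) f :
  phi (fsubst s f) = fsubst (phi \o s) f.
Proof.
rewrite [LHS](lrmorph_fsubst (phi \o fsubst s)).
by apply: eq_fsubst => v /=; rewrite fsubst_var.
Qed.

Lemma two_sided_ideal_ker (R S : pzRingType) (phi : {rmorphism R -> S}) :
  two_sided_ideal [set f | phi f = 0].
Proof.
split=> [|f g f0 g0|r f f0] /=; first exact: rmorph0.
  by rewrite rmorphB f0 g0 subrr.
by rewrite !rmorphM f0 mulr0 mul0r.
Qed.

(** In this lemma and in [rmorph_triple] the images are hypotheses, so that a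
    use of them needs no rewriting inside a concrete free algebra, whose
    operations unfold to sums over supports. *)
Lemma rmorph_commutator (R S : pzRingType) (phi : {rmorphism R -> S}) u v a b :
  phi u = a -> phi v = b -> phi (u * v - v * u) = a * b - b * a.
Proof. by move=> <- <-; rewrite rmorphB !rmorphM. Qed.

Lemma rmorph_triple (A B : pzRingType) (phi : {rmorphism A -> B}) u v w a b c :
    phi u = a -> phi v = b -> phi w = c ->
  phi (u * v * w - w * v * u) = a * b * c - c * b * a.
Proof. by move=> <- <- <-; rewrite rmorphB !rmorphM. Qed.

(** * Spans and graded identities of a graded algebra *)

Section LinearSpan.
Variables (K : pzRingType) (V : lmodType K) (S : set V).

Lemma sub_lspan : S `<=` lspan S.
Proof.
move=> v Sv; exists 1%N, (fun=> 1), (fun=> v); split=> //.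
by rewrite big_ord1 scale1r.
Qed.

Lemma lspan0 : lspan S 0.
Proof. by exists 0%N, (fun=> 0), (fun=> 0); rewrite big_ord0; split=> // -[]. Qed.

Lemma lspan_linear c v w : lspan S v -> lspan S w -> lspan S (c *: v + w).
Proof.
move=> [m [a [b [Sb ->]]]] [n [a' [b' [Sb' ->]]]].
exists (m + n)%N, (fun i => match split i with inl j => c * a j | inr k => a' k end).
exists (fun i => match split i with inl j => b j | inr k => b' k end).
split=> [i|]; first by case: split.
rewrite big_split_ord scaler_sumr; congr (_ + _); apply: eq_bigr => i _.
  by rewrite -[lshift _ _]/(unsplit (inl i)) unsplitK scalerA.
by rewrite -[rshift _ _]/(unsplit (inr i)) unsplitK.
Qed.

Lemma lspanZ c v : lspan S v -> lspan S (c *: v).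
Proof. by move=> Sv; rewrite -[_ *: _]addr0; apply: lspan_linear => //; apply: lspan0. Qed.

Lemma lspanD v w : lspan S v -> lspan S w -> lspan S (v + w).
Proof. by move=> Sv Sw; rewrite -[v]scale1r; apply: lspan_linear. Qed.

Lemma lspan_sum (I : Type) (r : seq I) (F : I -> V) :
  (forall i, lspan S (F i)) -> lspan S (\sum_(i <- r) F i).
Proof. by move=> SF; elim/big_ind: _ => //; [exact: lspan0 | exact: lspanD]. Qed.

Lemma lspan_ind (P : V -> Prop) :
    P 0 -> (forall c v w, P v -> P w -> P (c *: v + w)) ->
  (forall v, S v -> P v) -> forall v, lspan S v -> P v.
Proof.
move=> P0 Plin SP _ [n [c [b [Sb ->]]]]; elim/big_rec: _ => // i v _ Pv.
by apply: Plin => //; apply: SP.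
Qed.

End LinearSpan.

Section GradedIdentities.
Variables (K : fieldType) (G : zmodType) (A : algType K) (A_ : G -> set A).
Hypothesis A_lin : forall g c a b, A_ g a -> A_ g b -> A_ g (c *: a + b).
Hypothesis A_0 : forall g, A_ g 0.
Hypothesis A_1 : A_ 0 1.
Hypothesis A_M : forall g h a b, A_ g a -> A_ h b -> A_ (g + h) (a * b).

Lemma word_eval_homogeneous (s : (G * nat)%type -> A) w :
  (forall v, A_ v.1 (s v)) -> A_ (word_degree w) (word_eval s w).
Proof.
by move=> As; rewrite /word_degree /word_eval; elim/big_rec2: _ => // v a g _;
  apply: A_M.
Qed.

Lemma fsubst_homogeneous (s : (G * nat)%type -> A) g (f : gfreealg K G) :
  (forall v, A_ v.1 (s v)) -> gfree_grading g f -> A_ g (fsubst s f).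
Proof.
move=> As fg; rewrite fsubstE big_seq_cond; elim/big_rec: _ => // w a.
move=> /andP[/fg <- _]; apply: A_lin; exact: word_eval_homogeneous.
Qed.

Lemma gvar_homogeneous (v : (G * nat)%type) :
  @gfree_grading K G v.1 (fvar K v).
Proof.
move=> w; rewrite /fvar msuppU1 in_fset1 => /eqP ->.
by rewrite /word_degree fmU big_seq1.
Qed.

(** A graded endomorphism turns a degree-preserving substitution into another
    one, because a homogeneous element is evaluated to an element of its own
    degree. *)
Lemma graded_identities_T_ideal : graded_T_ideal (graded_identities A_).
Proof.
split=> [|phi phi_gr f idf s As].
  split=> [s _|f g idf idg s As|r f idf].
  - by rewrite raddf0.
  - by rewrite raddfB /= (idf s As) (idg s As) subrr.
  - by split=> s As; rewrite rmorphM /= (idf s As) ?mulr0 ?mul0r.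
have -> : fsubst s (phi f) = fsubst (fsubst s \o (phi \o @fvar K _)) f.
  rewrite (lrmorph_fsubst phi) (lrmorph_comp_fsubst (fsubst s)).
  by apply: eq_fsubst.
apply: idf => v; apply: fsubst_homogeneous => //.
by apply: phi_gr; apply: gvar_homogeneous.
Qed.

End GradedIdentities.

(** * The Weyl relation in characteristic p *)

Section ZpEmbedding.
Variables (K : fieldType) (p : nat).
Hypothesis char_K : p \in [pchar K].

Let p_gt1 : (1 < p)%N := prime_gt1 (pcharf_prime char_K).

(** The inclusion of the prime field. *)
Definition Zp_embed (i : 'Z_p) : K := (i : nat)%:R.

Lemma Zp_embed_nat n : Zp_embed n%:R = n%:R.
Proof. by rewrite /Zp_embed val_Zp_nat // GRing.natr_mod_pchar. Qed.

Lemma Zp_embedD i j : Zp_embed (i + j) = Zp_embed i + Zp_embed j.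
Proof. by rewrite -{1}[i]natr_Zp -{1}[j]natr_Zp -natrD Zp_embed_nat natrD. Qed.

Lemma Zp_embed0 : Zp_embed 0 = 0.
Proof. exact: Zp_embed_nat 0%N. Qed.

Lemma Zp_embed1 : Zp_embed 1 = 1.
Proof. exact: Zp_embed_nat 1%N. Qed.

Lemma Zp_embedN i : Zp_embed (- i) = - Zp_embed i.
Proof.
by apply: (addrI (Zp_embed i)); rewrite -Zp_embedD !subrr Zp_embed0.
Qed.

Lemma Zp_natr_eq0 n : (n%:R == 0 :> 'Z_p) = (p %| n)%N.
Proof. by rewrite -val_eqE /= val_Zp_nat. Qed.

Lemma Zp_embed_eq0 i : (Zp_embed i == 0) = (i == 0).
Proof.
rewrite /Zp_embed -(dvdn_pcharf char_K) -Zp_natr_eq0; congr (_ == _).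
exact: natr_Zp.
Qed.

End ZpEmbedding.

(** Any algebra with two elements satisfying the Weyl relation: the computations
    never look into the quotient that defines [W_1]. *)
Section WeylRelations.
Variables (K : fieldType) (A : algType K) (x y : A).
Hypothesis weyl_rel : y * x = x * y + 1.

Lemma weyl_ynx n : y ^+ n * x = x * y ^+ n + y ^+ n.-1 *+ n.
Proof.
elim: n => [|n IHn]; first by rewrite !expr0 mul1r mulr1 mulr0n addr0.
rewrite {1}exprS -mulrA IHn mulrDr mulrA weyl_rel mulrDl mul1r -mulrA -exprS.
rewrite -addrA mulrS; congr (_ + (_ + _)).
by case: n {IHn} => [|n]; rewrite ?mulr0n ?mulr0 // mulrnAr -exprS.
Qed.

Lemma weyl_yxn n : y * x ^+ n = x ^+ n * y + x ^+ n.-1 *+ n.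
Proof.
elim: n => [|n IHn]; first by rewrite !expr0 mul1r mulr1 mulr0n addr0.
rewrite {1}exprSr mulrA IHn mulrDl -mulrA weyl_rel mulrDr mulr1 mulrA -exprSr.
rewrite -addrA mulrS; congr (_ + (_ + _)).
by case: n {IHn} => [|n]; rewrite ?mulr0n ?mul0r // mulrnAl -exprSr.
Qed.

Local Notation t := (x * y).
Local Notation H := (horner_alg t).

(** Such a [z] satisfies [z q(t) = q(t - c) z] for every polynomial [q].
    For homogeneous [z] in characteristic [p], [c] is the degree of [z]. *)
Definition shifts (c : K) (z : A) := z * t = (t - c%:A) * z.

Lemma shiftsM c d z w : shifts c z -> shifts d w -> shifts (c + d) (z * w).
Proof.
rewrite /shifts => zt wt; rewrite -mulrA wt mulrA mulrBr zt.
rewrite -scalerAr mulr1 [RHS]mulrA; congr (_ * _).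
by rewrite scalerDl opprD addrA [RHS]mulrBl -[d *: 1 * z]scalerAl mul1r.
Qed.

Lemma shiftsX c z n : shifts c z -> shifts (c *+ n) (z ^+ n).
Proof.
move=> zt; elim: n => [|n IHn]; last by rewrite mulrS exprS; apply: shiftsM.
by rewrite /shifts mulr0n expr0 scale0r subr0 mul1r mulr1.
Qed.

Lemma shifts_horner c z q :
  shifts c z -> z * H q = H (q \Po ('X - c%:P)) * z.
Proof.
move=> zt; elim/poly_ind: q => [|q a IHq].
  by rewrite comp_poly0 raddf0 mulr0 mul0r.
rewrite comp_poly_MXaddC !raddfD /= !rmorphM raddfB /=.
rewrite !horner_algC !horner_algX mulrDr mulrDl mulrA IHq.
by rewrite -!mulrA zt -scalerAr mulr1 -scalerAl mul1r.
Qed.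

Definition generator (b : bool) : A := if b then y else x.

Lemma shifts_generator (b : bool) : shifts ((-1) ^+ b) (generator b).
Proof.
case: b; rewrite /shifts /generator /= ?expr1 ?expr0 ?scaleNr scale1r.
  by rewrite mulrA weyl_rel opprK.
by rewrite mulrBl mul1r -mulrA weyl_rel mulrDr mulr1 addrK.
Qed.

Lemma weyl_xnyn n : exists q, x ^+ n * y ^+ n = H q.
Proof.
elim: n => [|n [q IHn]]; first by exists 1; rewrite rmorph1 !expr0 mulr1.
exists ((q \Po ('X - 1%:P)) * 'X).
rewrite exprS exprSr -!mulrA (mulrA (x ^+ n)) IHn mulrA.
rewrite (shifts_horner _ (shifts_generator false)) /generator -mulrA.
by rewrite rmorphM /= horner_algX.
Qed.

(** Cancelling [x^k y^k], which is a polynomial in [t], leaves a power of one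
    generator. The degree equation is one of integers, hence holds in every
    ring. *)
Lemma weyl_monomial_normal r s :
  exists q b m, x ^+ r * y ^+ s = H q * generator b ^+ m /\
    forall R : pzRingType, ((-1) ^+ b *+ m : R) = r%:R - s%:R.
Proof.
have [le_sr|/ltnW le_rs] := leqP s r.
  have [q q_s] := weyl_xnyn s.
  have sh := shiftsX (r - s) (shifts_generator false).
  exists (q \Po ('X - ((-1) ^+ false *+ (r - s))%:P)), false, (r - s)%N; split.
    by rewrite -(shifts_horner _ sh) -q_s mulrA -exprD subnK.
  by move=> R; rewrite expr0 natrB.
have [q q_r] := weyl_xnyn r.
exists q, true, (s - r)%N; split=> [|R].
  by rewrite -q_r -mulrA -exprD subnKC.
by rewrite expr1 mulNrn natrB // opprB.
Qed.

Section PositiveCharacteristic.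
Variable p : nat.
Hypothesis char_K : p \in [pchar K].
Local Notation degree b m := ((-1) ^+ (b : bool) *+ m : 'Z_p).

Lemma degree_eq0 (b : bool) m : (degree b m == 0) = (p %| m)%N.
Proof.
rewrite -(Zp_natr_eq0 char_K); case: b; last by [].
by rewrite expr1 mulNrn oppr_eq0.
Qed.

Lemma Zp_embed_degree (b : bool) m : Zp_embed K (degree b m) = (-1) ^+ b *+ m.
Proof.
case: b; last exact: Zp_embed_nat.
by rewrite !expr1 !mulNrn Zp_embedN // Zp_embed_nat.
Qed.

(** The commutator of [y] and [x^m] is [m x^(m-1)], which vanishes when [p]
    divides [m]; likewise for [y^m] and [x]. *)
Lemma generator_pow_central b m c n :
  degree b m = 0 -> GRing.comm (generator b ^+ m) (generator c ^+ n).
Proof.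
move=> /eqP; rewrite degree_eq0 => p_m; apply: commrX.
have m0 (z : A) : z *+ m = 0.
  rewrite -mulr_natl -(scaler_nat m (1 : A)).
  by move: p_m; rewrite (dvdn_pcharf char_K) => /eqP ->; rewrite scale0r mul0r.
case: b c => -[]; rewrite /generator; first exact/commr_sym/commrX.
- by rewrite /GRing.comm weyl_ynx m0 addr0.
- by rewrite /GRing.comm weyl_yxn m0 addr0.
- exact/commr_sym/commrX.
Qed.

(** Two of the three generators coincide. If they are neighbours, their product
    is a power of degree [0], hence central. If they are the outer ones, the
    two exponents differ by a multiple of [p], and the power that accounts for
    the difference is central. *)
Lemma generator_pow_triple b1 m1 b2 m2 b3 m3 :
    degree b2 m2 = - degree b1 m1 -> degree b3 m3 = degree b1 m1 ->
  generator b1 ^+ m1 * generator b2 ^+ m2 * generator b3 ^+ m3 =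
  generator b3 ^+ m3 * generator b2 ^+ m2 * generator b1 ^+ m1.
Proof.
move=> deg2 deg3.
have pow_addC b m n : generator b ^+ m * generator b ^+ n = generator b ^+ n * generator b ^+ m.
  by rewrite -!exprD addnC.
have [eq12|ne12] := eqVneq b1 b2.
  rewrite -eq12 in deg2 *; rewrite -[RHS]mulrA [in RHS]pow_addC -exprD.
  by apply: generator_pow_central; rewrite mulrnDr deg2 subrr.
have [eq23|ne23] := eqVneq b2 b3.
  rewrite -eq23 in deg3 *; rewrite -[LHS]mulrA [in LHS]pow_addC -exprD.
  by apply/esym/generator_pow_central; rewrite mulrnDr deg2 deg3 subrr.
have {ne12 ne23} eq13 : b3 = b1 by case: b1 b2 b3 ne12 ne23 {deg2 deg3} => [] [] [].
rewrite {b3}eq13 in deg3 *.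
have swap m n : (m <= n)%N -> degree b1 m = degree b1 n ->
    generator b1 ^+ m * generator b2 ^+ m2 * generator b1 ^+ n =
    generator b1 ^+ n * generator b2 ^+ m2 * generator b1 ^+ m.
  move=> le_mn eq_mn; have deg0 : degree b1 (n - m) = 0.
    by rewrite mulrnBr // eq_mn subrr.
  have comm_d : GRing.comm (generator b1 ^+ (n - m))
      (generator b1 ^+ m * generator b2 ^+ m2 * generator b1 ^+ m).
    by do ?apply: commrM; apply: generator_pow_central.
  by rewrite -(subnK le_mn) [in LHS]addnC !exprD mulrA -comm_d !mulrA.
by have [/swap->//|/ltnW/swap->] := leqP m1 m3.
Qed.

(** Moving the polynomials in [t] to the left gives, with [s] the shift by
    [alpha], the coefficient [q1 s(q2) q3] on one side and [q3 s(q2) q1] on the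
    other, and the powers of the generators are exchanged by
    [generator_pow_triple]. *)
Lemma monomial_triple r1 s1 r2 s2 r3 s3 :
    r2%:R - s2%:R = - (r1%:R - s1%:R) :> 'Z_p ->
    r3%:R - s3%:R = r1%:R - s1%:R :> 'Z_p ->
  (x ^+ r1 * y ^+ s1) * (x ^+ r2 * y ^+ s2) * (x ^+ r3 * y ^+ s3) =
  (x ^+ r3 * y ^+ s3) * (x ^+ r2 * y ^+ s2) * (x ^+ r1 * y ^+ s1).
Proof.
have [q1 [b1 [m1 [-> /(_ 'Z_p) <-]]]] := weyl_monomial_normal r1 s1.
have [q2 [b2 [m2 [-> /(_ 'Z_p) <-]]]] := weyl_monomial_normal r2 s2.
have [q3 [b3 [m3 [-> /(_ 'Z_p) <-]]]] := weyl_monomial_normal r3 s3.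
move=> deg2 deg3; set k := Zp_embed K (degree b1 m1).
have shift b m : shifts (Zp_embed K (degree b m)) (generator b ^+ m).
  by rewrite Zp_embed_degree; exact: shiftsX (shifts_generator b).
have shift1 : shifts k (generator b1 ^+ m1) by exact: shift.
have shift2 : shifts (- k) (generator b2 ^+ m2).
  by rewrite -Zp_embedN // -deg2; apply: shift.
have shift3 : shifts k (generator b3 ^+ m3) by rewrite /k -deg3; apply: shift.
(* The first two shifts cancel, so the last coefficient is not shifted. *)
have move_left q q' q'' z w u : shifts k z -> shifts (- k) w ->
    H q * z * (H q' * w) * (H q'' * u) =
    H (q * (q' \Po ('X - k%:P)) * q'') * (z * w * u).
  move=> zk wk; rewrite !rmorphM -!mulrA; congr (_ * _).
  rewrite [in LHS]mulrA (shifts_horner _ zk) -!mulrA; congr (_ * _).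
  rewrite [in LHS](mulrA w) !(mulrA z) (shifts_horner _ (shiftsM zk wk)).
  by rewrite subrr subr0 comp_polyXr -!mulrA.
rewrite (move_left _ _ _ _ _ _ shift1 shift2) (move_left _ _ _ _ _ _ shift3 shift2).
rewrite (generator_pow_triple deg2 deg3).
by rewrite mulrAC [q1 * q3]mulrC mulrAC.
Qed.

(** For [W_1] this is the degree [k] part of its grading. *)
Definition homogeneous_part (k : 'Z_p) : set A :=
  lspan [set a | exists r s : nat,
    r%:R - s%:R = k :> 'Z_p /\ a = x ^+ r * y ^+ s].

Lemma homogeneous_triple k a b c :
    homogeneous_part k a -> homogeneous_part (- k) b -> homogeneous_part k c ->
  a * b * c = c * b * a.
Proof.
move=> Aa Ab Ac; move: a Aa; apply: lspan_ind => [|l a a' IHa IHa'|].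
- by rewrite mulr0 !mul0r.
- by rewrite mulrDl mulrDl mulrDr -!scalerAl -scalerAr IHa IHa'.
move=> _ [r1 [s1 [deg1 ->]]].
move: b Ab; apply: lspan_ind => [|l b b' IHb IHb'|].
- by rewrite !(mulr0, mul0r).
- by rewrite !(mulrDr, mulrDl) -!(scalerAr, scalerAl) IHb IHb'.
move=> _ [r2 [s2 [deg2 ->]]].
move: c Ac; apply: lspan_ind => [|l c c' IHc IHc'|].
- by rewrite mulr0 !mul0r.
- by rewrite mulrDr !mulrDl -scalerAr -!scalerAl IHc IHc'.
move=> _ [r3 [s3 [deg3 ->]]].
by apply: monomial_triple; rewrite ?deg1 ?deg2 ?deg3.
Qed.

Lemma homogeneous_part1 : homogeneous_part 0 1.
Proof. by apply: sub_lspan; exists 0%N, 0%N; rewrite subrr !expr0 mulr1. Qed.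

Lemma homogeneous_monomial r s k :
  r%:R - s%:R = k -> homogeneous_part k (x ^+ r * y ^+ s).
Proof. by move=> <-; apply: sub_lspan; exists r, s. Qed.

Lemma homogeneous_mulx k a : homogeneous_part k a -> homogeneous_part (k + 1) (a * x).
Proof.
move: a; apply: lspan_ind => [|c a b IHa IHb|_ [r [s [<- ->]]]].
- by rewrite mul0r; apply: lspan0.
- by rewrite mulrDl -scalerAl; apply: lspan_linear.
rewrite -mulrA weyl_ynx mulrDr mulrA -exprSr; apply: lspanD.
  by apply: homogeneous_monomial; rewrite mulrSr addrAC.
case: s => [|s]; first by rewrite mulr0n mulr0; apply: lspan0.
rewrite mulrnAr -scaler_nat; apply: lspanZ.
by apply: homogeneous_monomial; rewrite mulrSr opprD addrA subrK.
Qed.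

Lemma homogeneous_muly k a : homogeneous_part k a -> homogeneous_part (k - 1) (a * y).
Proof.
move: a; apply: lspan_ind => [|c a b IHa IHb|_ [r [s [<- ->]]]].
- by rewrite mul0r; apply: lspan0.
- by rewrite mulrDl -scalerAl; apply: lspan_linear.
rewrite -mulrA -exprSr; apply: homogeneous_monomial.
by rewrite mulrSr opprD addrA.
Qed.

Lemma homogeneousM k l a b :
  homogeneous_part k a -> homogeneous_part l b -> homogeneous_part (k + l) (a * b).
Proof.
move=> Aa; move: b; apply: lspan_ind => [|c b b' IHb IHb'|_ [r [s [<- ->]]]].
- by rewrite mulr0; apply: lspan0.
- by rewrite mulrDr -scalerAr; apply: lspan_linear.
rewrite mulrA addrA; elim: s => [|s IHs]; last first.
  by rewrite exprSr mulrA mulrSr opprD addrA; apply: homogeneous_muly.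
rewrite subr0 expr0 mulr1; elim: r => [|r IHr]; first by rewrite addr0 mulr1.
by rewrite exprSr mulrA mulrSr addrA; apply: homogeneous_mulx.
Qed.

Lemma homogeneous_xyx (r s r' : nat) k :
  r%:R - s%:R + r'%:R = k -> homogeneous_part k (x ^+ r * y ^+ s * x ^+ r').
Proof.
move=> <-; apply: homogeneousM; first exact: homogeneous_monomial.
have := @homogeneous_monomial r' 0%N r'%:R (subr0 _).
by rewrite expr0 mulr1.
Qed.

End PositiveCharacteristic.
End WeylRelations.

(** * Words as walks *)

Section Walks.
Variable G : zmodType.
Local Notation letter := (G * nat)%type.

Definition displacement (w : seq letter) : G := \sum_(v <- w) v.1.

Fixpoint steps (i : G) (w : seq letter) : seq (letter * G) :=
  if w is v :: w' then (v, i) :: steps (i + v.1) w' else [::].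

Lemma displacement_cat u w : displacement (u ++ w) = displacement u + displacement w.
Proof. exact: big_cat. Qed.

Lemma displacement_cons v w : displacement (v :: w) = v.1 + displacement w.
Proof. exact: big_cons. Qed.

Lemma displacement_nil : displacement [::] = 0.
Proof. exact: big_nil. Qed.

Lemma steps_cat i u w :
  steps i (u ++ w) = steps i u ++ steps (i + displacement u) w.
Proof.
elim: u i => [|v u IHu] i /=; first by rewrite displacement_nil addr0.
by rewrite IHu displacement_cons addrA.
Qed.

Lemma size_steps i w : size (steps i w) = size w.
Proof. by elim: w i => //= v w IHw i; rewrite IHw. Qed.

Lemma steps_first (P : pred (letter * G)) i w : has P (steps i w) ->
  exists u v u', [/\ w = u ++ v :: u', P (v, i + displacement u)
    & ~~ has P (steps i u)].
Proof.
elim: w i => //= v w IHw i; have [Pv _|notPv /IHw] := boolP (P (v, i)).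
  by exists [::], v, w; rewrite displacement_nil addr0.
move=> [u [v' [u' [-> Pv' notPu]]]]; exists (v :: u), v', u'.
by rewrite displacement_cons addrA /= negb_or notPv.
Qed.

(** [E] stands for equality modulo a graded T-ideal; [E_swap] is the triple
    identity applied at the beginning of a word. *)
Variable E : seq letter -> seq letter -> Prop.
Hypothesis E_refl : forall u, E u u.
Hypothesis E_trans : forall u v w, E u v -> E v w -> E u w.
Hypothesis E_cons : forall v u w, E u w -> E (v :: u) (v :: w).
Hypothesis E_swap : forall a b c d,
    displacement b = - displacement a -> displacement c = displacement a ->
  E (a ++ b ++ c ++ d) (c ++ b ++ a ++ d).

(** Write [w = a (v b)] with [a] a closed walk at [i] that does not use the step
    [(v, i)]. In the other walk, which begins with [(v, i)], take the first step
    lying in [a]; the step before it lies in [v b] and ends at a vertex [j].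
    Hence [a = a1 a2] and [v b = c1 c2] with [a1] and [c1] both leading from [i]
    to [j], [a2] leading back and [c1] nonempty, and [a1 a2 c1 c2] can be
    exchanged for [c1 a2 a1 c2], which begins with [v]. *)
Lemma bring_step_first i v u w : perm_eq (steps i (v :: u)) (steps i w) ->
  exists2 w', E w (v :: w') & perm_eq (steps i (v :: w')) (steps i w).
Proof.
move=> eq_uw; have : has (pred1 (v, i)) (steps i w).
  by rewrite has_pred1 -(perm_mem eq_uw) mem_head.
move=> /steps_first[a [v' [b [def_w /eqP[ev ia] v_notin_a]]]].
have {ia} a0 : displacement a = 0 by apply: (addrI i); rewrite ia addr0.
rewrite {v'}ev in def_w; rewrite {w}def_w in eq_uw *; rewrite has_pred1 in v_notin_a.
have [a_nil|a_nonempty] := eqVneq a [::]; first by exists b; rewrite a_nil.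
have : has (mem (steps i a)) (steps i (v :: u)).
  case: a a_nonempty {a0 v_notin_a} eq_uw => // h a _ eq_uw.
  apply/hasP; exists (h, i); last exact: mem_head.
  by rewrite (perm_mem eq_uw) mem_head.
move=> /steps_first[u1 [e [u2 [def_u e_in_a u1_notin_a]]]].
case/lastP: u1 => [|u1 f] in def_u e_in_a u1_notin_a.
  move: def_u e_in_a => [<- _]; rewrite displacement_nil addr0 /=.
  by rewrite (negPf v_notin_a).
have : (f, i + displacement u1) \in steps i (v :: b).
  have : (f, i + displacement u1) \in steps i (a ++ v :: b).
    by rewrite -(perm_mem eq_uw) def_u -cats1 -catA steps_cat mem_cat mem_head orbT.
  rewrite steps_cat a0 addr0 mem_cat => /orP[f_in_a|//].
  case/hasP: u1_notin_a; exists (f, i + displacement u1) => //.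
  by rewrite -cats1 steps_cat mem_cat mem_head orbT.
rewrite -has_pred1 => /steps_first[c1 [f' [c2 [def_b /eqP[ef ic1] _]]]].
rewrite {f'}ef in def_b.
move: e_in_a => /=; rewrite -has_pred1.
move=> /steps_first[a1 [e' [a2 [def_a /eqP[ee ia1] _]]]].
rewrite {e'}ee in def_a.
set j := i + displacement (rcons u1 f) in ia1.
have disp_c : i + displacement (rcons c1 f) = j.
  by rewrite /j -!cats1 !displacement_cat !addrA ic1.
have disp_a2 : displacement (e :: a2) = - displacement a1.
  by apply/eqP; rewrite -addr_eq0 addrC -displacement_cat -def_a a0.
(* Here [rcons c1 f] and [e :: a2] are the segments [c1] and [a2] above. *)
have [w' def_w'] : exists w', rcons c1 f ++ (e :: a2) ++ a1 ++ c2 = v :: w'.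
  case: c1 def_b {ic1 disp_c} => [|h c1] [-> _]; first by eexists.
  by eexists.
have def_vb : v :: b = rcons c1 f ++ c2 by rewrite cat_rcons.
exists w'.
  rewrite -def_w' def_a def_vb -catA.
  by apply: E_swap => //; apply: (addrI i); rewrite disp_c.
rewrite -[(v, i) :: _]/(steps i (v :: w')) -def_w' def_a def_vb -catA.
have ja2 : j + displacement (e :: a2) = i.
  by rewrite -ia1 -addrA disp_a2 subrr addr0.
rewrite !steps_cat !disp_c ia1 ja2 ia1 disp_c.
by rewrite perm_catCA perm_sym perm_catCA perm_cat2l perm_catCA.
Qed.

Lemma perm_steps_equiv i u w : perm_eq (steps i u) (steps i w) -> E w u.
Proof.
elim: u i w => [|v u IHu] i w eq_uw.
  by case: w eq_uw => // v w /perm_size.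
have [w' E_ww' eq_ww'] := bring_step_first eq_uw.
apply: E_trans E_ww' _; apply: E_cons; apply: (IHu (i + v.1)).
by rewrite -(perm_cons (v, i)); apply: perm_trans eq_uw _; rewrite perm_sym.
Qed.

End Walks.

(** * Words modulo a graded T-ideal *)

(** Kept over an abstract ring: in the free algebra, rewriting with
    associativity unfolds the product. *)
Lemma triple_mulr (R : pzRingType) (a b c d : R) :
  a * (b * (c * d)) - c * (b * (a * d)) = (a * b * c - c * b * a) * d.
Proof. by rewrite mulrBl !mulrA. Qed.

Section FreeGrading.
Variables (K : fieldType) (G : zmodType).
Local Notation F := (gfreealg K G).

Definition word (w : seq (G * nat)) : F := << FMonom w >>.

Lemma word_cat u w : word (u ++ w) = word u * word w.
Proof.
by apply: esym; rewrite [LHS]fgmulUU mulr1 /mmul /= fmmulE.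
Qed.

Lemma word_homogeneous w : gfree_grading (displacement w) (word w).
Proof. by move=> u; rewrite msuppU1 in_fset1 => /eqP ->. Qed.

Lemma gfree_grading_lin g c (a b : F) :
  gfree_grading g a -> gfree_grading g b -> gfree_grading g (c *: a + b).
Proof.
move=> ag bg w /(fsubsetP (msuppD_le _ _)); rewrite in_fsetU.
by case/orP=> [/(fsubsetP (msuppZ_le _ _))/ag|/bg].
Qed.

Lemma gfree_grading0 g : gfree_grading g (0 : F).
Proof. by move=> w; rewrite msupp0. Qed.

Lemma gfree_grading1 : gfree_grading 0 (1 : F).
Proof.
move=> w; rewrite msuppU1 in_fset1 => /eqP ->.
by rewrite /word_degree fm1 big_nil.
Qed.

Lemma gfree_gradingM g h (a b : F) :
  gfree_grading g a -> gfree_grading h b -> gfree_grading (g + h) (a * b).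
Proof.
move=> ag bh w /(fsubsetP (msuppM_incl _ _))/imfset2P[u /ag <- [v /bh <- ->]].
by rewrite /word_degree fmM big_cat.
Qed.

Lemma fsubst_graded_endo (s : (G * nat)%type -> F) :
  (forall v, gfree_grading v.1 (s v)) -> graded_endo (fsubst s : F -> F).
Proof.
move=> s_gr g f fg; apply: fsubst_homogeneous fg => //.
- exact: gfree_grading_lin.
- exact: gfree_grading0.
- exact: gfree_grading1.
- exact: gfree_gradingM.
Qed.

Variable I : set F.
Hypothesis I_T_ideal : graded_T_ideal I.
Hypothesis I_triple : forall alpha,
  I (gvar K alpha 1%N * gvar K (- alpha) 2%N * gvar K alpha 3%N -
     gvar K alpha 3%N * gvar K (- alpha) 2%N * gvar K alpha 1%N).

Lemma T_ideal0 : I 0. Proof. by have [[]] := I_T_ideal. Qed.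

Lemma T_idealB f g : I f -> I g -> I (f - g).
Proof. by have [[_ IB _] _] := I_T_ideal; apply: IB. Qed.

Lemma T_idealD f g : I f -> I g -> I (f + g).
Proof.
move=> If Ig; rewrite -[g]opprK; apply: T_idealB => //.
by rewrite -sub0r; apply: T_idealB => //; apply: T_ideal0.
Qed.

Lemma T_idealMl r f : I f -> I (r * f).
Proof. by move=> If; have [[_ _ IM] _] := I_T_ideal; exact: (IM r f If).1. Qed.

Lemma T_idealMr r f : I f -> I (f * r).
Proof. by move=> If; have [[_ _ IM] _] := I_T_ideal; exact: (IM r f If).2. Qed.

Lemma T_idealZ c f : I f -> I (c *: f).
Proof. by move=> If; rewrite -mulr_algl; apply: T_idealMl. Qed.

(** The endomorphism that replaces the three variables by [a], [b] and [c] is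
    graded. *)
Lemma T_ideal_triple alpha (a b c : F) :
    gfree_grading alpha a -> gfree_grading (- alpha) b ->
    gfree_grading alpha c ->
  I (a * b * c - c * b * a).
Proof.
move=> a_gr b_gr c_gr.
pose s (v : G * nat) : F :=
  if v == (alpha, 1%N) then a else if v == (- alpha, 2%N) then b
  else if v == (alpha, 3%N) then c else fvar K v.
have s_gr v : gfree_grading v.1 (s v).
  rewrite /s; do ![case: eqP => [-> //|_]]; exact: gvar_homogeneous.
have [phi phiE] : exists phi : {lrmorphism F -> F}, forall f, phi f = fsubst s f.
  by exists (@fsubst K (G * nat)%type F s).
have phi_gr : graded_endo phi.
  by move=> g f fg; rewrite phiE; apply: fsubst_graded_endo.
have [_ /(_ phi phi_gr _ (I_triple alpha))] := I_T_ideal.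
have phi_var v : phi (fvar K v) = s v by rewrite phiE fsubst_var.
have phi1 : phi (gvar K alpha 1%N) = a by rewrite phi_var /s eqxx.
have phi2 : phi (gvar K (- alpha) 2%N) = b by rewrite phi_var /s xpair_eqE andbF eqxx.
have phi3 : phi (gvar K alpha 3%N) = c by rewrite phi_var /s !xpair_eqE !andbF !eqxx.
by rewrite (rmorph_triple phi1 phi2 phi3).
Qed.

Lemma T_ideal_triple_mul alpha (a b c d : F) :
    gfree_grading alpha a -> gfree_grading (- alpha) b ->
    gfree_grading alpha c ->
  I (a * (b * (c * d)) - c * (b * (a * d))).
Proof.
move=> a_gr b_gr c_gr.
rewrite triple_mulr.
exact/T_idealMr/(T_ideal_triple a_gr).
Qed.

Lemma T_ideal_swap (a b c d : seq (G * nat)) :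
    displacement b = - displacement a -> displacement c = displacement a ->
  I (word (a ++ b ++ c ++ d) - word (c ++ b ++ a ++ d)).
Proof.
move=> b_a c_a; rewrite !word_cat.
apply: (@T_ideal_triple_mul (displacement a)); first exact: word_homogeneous.
  by rewrite -b_a; apply: word_homogeneous.
by rewrite -c_a; apply: word_homogeneous.
Qed.

Lemma perm_steps_T_ideal u w :
  perm_eq (steps 0 u) (steps 0 w) -> I (word u - word w).
Proof.
rewrite perm_sym.
apply: (@perm_steps_equiv _ (fun u w => I (word u - word w))).
- by move=> v; rewrite subrr; apply: T_ideal0.
- by move=> v1 v2 v3 /T_idealD/[apply]; rewrite addrA subrK.
- move=> v u' w' Iuw; rewrite -[v :: u']cat1s -[v :: w']cat1s !word_cat -mulrBr.
  exact: T_idealMl.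
- exact: T_ideal_swap.
Qed.

End FreeGrading.

(** * Kronecker substitution *)

Section Kronecker.

Lemma infinite_poly_eq0 (K : fieldType) (P : {poly K}) :
  infinite_set [set: K] -> (forall z, P.[z] = 0) -> P = 0.
Proof.
move=> K_inf P0; apply/eqP/negP => /negP P_neq0.
have [B _ le_PB] := infinite_set_fset (size P) K_inf.
have : (size (enum_fset B) < size P)%N.
  apply: max_poly_roots P_neq0 _ (fset_uniq B).
  by apply/allP => z _; apply/rootP; apply: P0.
by rewrite ltnNge le_PB.
Qed.

Variable T : eqType.

(** The exponent of [z] in the product of the [xi(t)], [t] in [m], when
    [xi(t) = z^(N^index(t))]. Its digits in base [N] are the multiplicities of
    the elements of [L] in [m]. *)
Definition kronecker (N : nat) (L m : seq T) : nat :=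
  (\sum_(t <- m) N ^ index t L)%N.

Lemma kronecker_cons N t L m : kronecker N (t :: L) m =
  (count_mem t m + N * kronecker N L [seq u <- m | u != t])%N.
Proof.
rewrite /kronecker big_filter big_distrr /= (bigID (pred1 t)) /=; congr (_ + _)%N.
  rewrite (eq_bigr (fun=> 1%N)) => [|u /eqP->]; last by rewrite eqxx.
  by rewrite sum1_count.
by apply: eq_bigr => u /negPf; rewrite eq_sym => ->; rewrite expnS.
Qed.

Lemma kronecker_count N L m m' : (size m < N)%N -> (size m' < N)%N ->
  kronecker N L m = kronecker N L m' ->
  {in L, forall t, count_mem t m = count_mem t m'}.
Proof.
elim: L m m' => // t L IHL m m' lt_m lt_m'; rewrite !kronecker_cons => eq_k.
have lt_count s : (size s < N)%N -> (count_mem t s < N)%N.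
  exact/leq_ltn_trans/count_size.
have N_gt0 : (0 < N)%N by apply: leq_ltn_trans lt_m.
have eq_t : count_mem t m = count_mem t m'.
  have := congr1 (modn^~ N) eq_k.
  by rewrite ![(_ + N * _)%N]addnC ![(N * _)%N]mulnC !modnMDl !modn_small ?lt_count.
move=> u; rewrite inE; have [->|ne_ut] //= := eqVneq u t => uL.
have count_filter s : count_mem u [seq x <- s | x != t] = count_mem u s.
  rewrite count_filter; apply: eq_count => x /=.
  by have [->|] := eqVneq x u; rewrite ?ne_ut.
rewrite -count_filter -[RHS]count_filter; apply: IHL => //.
- by apply: leq_ltn_trans lt_m; rewrite size_filter count_size.
- by apply: leq_ltn_trans lt_m'; rewrite size_filter count_size.
by move/eqP: eq_k; rewrite eq_t eqn_add2l eqn_pmul2l // => /eqP.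
Qed.

Lemma kronecker_perm N L m m' : (size m < N)%N -> (size m' < N)%N ->
    {subset m <= L} -> {subset m' <= L} ->
  kronecker N L m = kronecker N L m' -> perm_eq m m'.
Proof.
move=> lt_m lt_m' mL m'L /kronecker_count eq_count.
apply/allP => t; rewrite mem_cat => t_in; apply/eqP/eq_count => //.
by case/orP: t_in => [/mL|/m'L].
Qed.

End Kronecker.

(** * Homogeneous elements of W_1 acting as weighted shifts *)

Section WeylRepresentation.
Variable K : fieldType.

Lemma weyl_lift (B : algType K) (a b : B) : b * a - a * b = 1 ->
  exists psi : {lrmorphism weyl K -> B}, psi (weyl_x K) = a /\ psi (weyl_y K) = b.
Proof.
move=> rel.
have [rho rhoE] : exists rho : {lrmorphism freealg K bool -> B},
    forall c : bool, rho (fvar K c) = if c then b else a.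
  by exists (fsubst (fun c : bool => if c then b else a)) => c; apply: fsubst_var.
have ker f : weyl_ideal f -> rho f = 0.
  suff : @weyl_ideal K `<=` [set f | rho f = 0] by apply.
  apply: smallest_sub => [|_ ->]; first exact: two_sided_ideal_ker.
  apply: etrans (rmorphB rho _ _) _.
  by rewrite (rmorph_commutator (rhoE true) (rhoE false)) rel (rmorph1 rho) subrr.
pose psi (u : weyl K) := rho (repr u).
have psi_pi f : psi (weyl_pi f) = rho f.
  apply/eqP; rewrite -subr_eq0; apply/eqP.
  apply: etrans (esym (raddfB rho _ _)) _; apply/ker/weyl_piP.
  exact: weyl_reprK.
have psiB : zmod_morphism psi.
  elim/weyl_pi_ind=> f; elim/weyl_pi_ind=> g.
  by rewrite -raddfB !psi_pi; apply: raddfB.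
have psiM : monoid_morphism psi.
  split; first by rewrite -(rmorph1 (@weyl_pi K)) psi_pi; apply: rmorph1.
  elim/weyl_pi_ind=> f; elim/weyl_pi_ind=> g.
  by rewrite -rmorphM !psi_pi; apply: rmorphM.
have psiZ : scalable psi.
  by move=> c; elim/weyl_pi_ind=> f; rewrite -linearZ !psi_pi linearZ.
pose psi_add := GRing.isZmodMorphism.Build _ _ psi psiB.
pose psi_mul := GRing.isMonoidMorphism.Build _ _ psi psiM.
pose psi_scale := GRing.isScalable.Build K _ _ *:%R psi psiZ.
pose psi' : {lrmorphism weyl K -> B} := HB.pack psi psi_add psi_mul psi_scale.
by exists psi'; rewrite /= !psi_pi !rhoE.
Qed.

Variable p : nat.
Hypothesis char_K : p \in [pchar K].
Let p_gt1 : (1 < p)%N := prime_gt1 (pcharf_prime char_K).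
Local Notation n := (Zp_trunc p).+2.
Local Notation kappa := (@Zp_embed K p).

(** Square matrices indexed by [Z_p] act on column vectors, that is, on
    functions on [Z_p]. *)
Definition shift_mx : 'M[K]_n := \matrix_(i, j) (j == i + 1)%:R.
Definition weighted_shift_mx : 'M[K]_n :=
  \matrix_(i, j) (- kappa i *+ (j == i - 1)).
Local Notation X := shift_mx.
Local Notation Y := weighted_shift_mx.

Lemma shift_mxE (v : 'cV[K]_n) i : (X *m v) i 0 = v (i + 1) 0.
Proof.
rewrite mxE (bigD1 (i + 1)) //= mxE eqxx mul1r big1 ?addr0 // => j /negPf ne.
by rewrite mxE ne mul0r.
Qed.

Lemma weighted_shift_mxE (v : 'cV[K]_n) i :
  (Y *m v) i 0 = - kappa i * v (i - 1) 0.
Proof.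
rewrite mxE (bigD1 (i - 1)) //= mxE eqxx big1 ?addr0 // => j /negPf ne.
by rewrite mxE ne mul0r.
Qed.

Lemma mx_col_ext (M N : 'M[K]_n) :
  (forall (v : 'cV_n) i, (M *m v) i 0 = (N *m v) i 0) -> M = N.
Proof.
move=> eq_MN; apply/matrixP => i j.
by have := eq_MN (delta_mx j 0) i; rewrite -!colE !mxE.
Qed.

Lemma weyl_relation_mx : Y * X - X * Y = 1.
Proof.
apply: mx_col_ext => v i; rewrite mulmxBl mul1mx mxE [X in _ + X = _]mxE -!mulmxA.
rewrite !(shift_mxE, weighted_shift_mxE) subrK addrK Zp_embedD // Zp_embed1 //.
by rewrite -mulrBl opprK addKr mul1r.
Qed.

Lemma shift_mxXE a (v : 'cV[K]_n) i : (X ^+ a *m v) i 0 = v (i + a%:R) 0.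
Proof.
elim: a i => [|a IHa] i; first by rewrite mul1mx addr0.
by rewrite exprS -mulmxA shift_mxE IHa mulrS addrA.
Qed.

(** The coefficient with which [y^(p-1)] maps the value at [i + 1] to the value
    at [i]. The factors [k - i], [k < p - 1], are all nonzero only for
    [i = -1]. *)
Definition top_weight (i : 'Z_p) : K := \prod_(k < p.-1) - kappa (i - k%:R).

Lemma weighted_shift_mxXE a (v : 'cV[K]_n) i :
  (Y ^+ a *m v) i 0 = (\prod_(k < a) - kappa (i - k%:R)) * v (i - a%:R) 0.
Proof.
elim: a i => [|a IHa] i; first by rewrite mul1mx big_ord0 mul1r subr0.
rewrite exprS -mulmxA weighted_shift_mxE IHa big_ord_recl subr0 mulrA.
rewrite mulrS opprD addrA; congr (_ * _ * _); apply: eq_bigr => k _.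
by rewrite lift0 mulrS opprD addrA.
Qed.

Lemma Zp_natr_pred : (p.-1)%:R = - 1 :> 'Z_p.
Proof.
apply/eqP; rewrite -subr_eq0 opprK -mulrSr prednK ?(ltnW p_gt1) //.
by rewrite (Zp_natr_eq0 char_K).
Qed.

Lemma top_weight_neq0 i : (top_weight i != 0) = (i == -1).
Proof.
apply/idP/eqP => [nz|->].
  have [lt_i|le_i] := ltnP i p.-1.
    case/negP: nz; rewrite /top_weight (bigD1 (Ordinal lt_i)) //=.
    by rewrite natr_Zp subrr Zp_embed0 // oppr0 mul0r.
  rewrite -Zp_natr_pred -[i]natr_Zp; congr _%:R.
  apply/eqP; rewrite eqn_leq le_i andbT -ltnS prednK ?(ltnW p_gt1) //.
  by rewrite -[X in (_ < X)%N](Zp_cast p_gt1) ltn_ord.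
apply/prodf_neq0 => k _; rewrite oppr_eq0 Zp_embed_eq0 // -opprD oppr_eq0.
rewrite -mulrS (Zp_natr_eq0 char_K) gtnNdvd //.
by rewrite -[X in (_ < X)%N]prednK ?(ltnW p_gt1) // ltnS.
Qed.

Variable psi : {lrmorphism weyl K -> 'M[K]_n}.
Hypothesis psi_x : psi (weyl_x K) = X.
Hypothesis psi_y : psi (weyl_y K) = Y.

(** The factor [y^(p-1)] acts as [top_weight (-1)] times the matrix unit of
    position [(-1, 0)]; the powers of [x] around it move this unit to
    [(j, j + g)]. *)
Definition generic_element (g : 'Z_p) (xi : 'Z_p -> K) : weyl K :=
  \sum_j (xi j / top_weight (-1)) *:
    (weyl_x K ^+ ((-1 - j)%R : 'Z_p) * weyl_y K ^+ p.-1 * weyl_x K ^+ ((j + g)%R : 'Z_p)).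

Lemma weyl_yx : weyl_y K * weyl_x K = weyl_x K * weyl_y K + 1.
Proof. by apply/eqP; rewrite addrC -subr_eq weyl_comm. Qed.

Lemma generic_element_homogeneous g xi :
  weyl_grading K p g (generic_element g xi).
Proof.
apply: lspan_sum => j; apply: lspanZ.
apply: (_ : homogeneous_part (weyl_x K) (weyl_y K) g _).
apply: homogeneous_xyx; first exact: weyl_yx.
by rewrite !natr_Zp Zp_natr_pred opprK [-1 - j]addrC subrK addKr.
Qed.

Lemma monomial_mxE c a b (v : 'cV[K]_n) i :
  (psi (c *: (weyl_x K ^+ a * weyl_y K ^+ p.-1 * weyl_x K ^+ b)) *m v) i 0 =
  c * (top_weight (i + a%:R) * v (i + a%:R + 1 + b%:R) 0).
Proof.
rewrite linearZ !rmorphM !rmorphXn /= psi_x psi_y -scalemxAl mxE -!mulmxA.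
by rewrite shift_mxXE weighted_shift_mxXE shift_mxXE Zp_natr_pred opprK.
Qed.

Lemma generic_elementE g xi (v : 'cV[K]_n) i :
  (psi (generic_element g xi) *m v) i 0 = xi i * v (i + g) 0.
Proof.
rewrite raddf_sum mulmx_suml summxE (bigD1 i) // big1 => [|j ne_ji].
  rewrite [LHS]addr0 monomial_mxE !natr_Zp [i + _]addrC subrK addNr add0r.
  by rewrite mulrA divfK // top_weight_neq0.
rewrite monomial_mxE natr_Zp.
have /eqP-> : top_weight (i + (-1 - j)) == 0.
  rewrite -[_ == 0]negbK top_weight_neq0 addrCA -subr_eq0 opprK addrAC addNr add0r.
  by rewrite subr_eq0 eq_sym.
by rewrite mul0r mulr0.
Qed.

End WeylRepresentation.

(** * Graded identities of W_1 *)

Section GenericEvaluation.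
Variables (K : fieldType) (p : nat).
Hypothesis char_K : p \in [pchar K].
Local Notation letter := ('Z_p * nat)%type.
Local Notation n := (Zp_trunc p).+2.

Lemma word_eval_steps (M : letter -> 'M[K]_n) (xi : letter * 'Z_p -> K) :
    (forall v (u : 'cV[K]_n) i, (M v *m u) i 0 = xi (v, i) * u (i + v.1) 0) ->
  forall (w : seq letter) i,
    ((\prod_(v <- w) M v) *m (const_mx 1 : 'cV[K]_n)) i 0 =
    \prod_(t <- steps i w) xi t.
Proof.
move=> ME; elim=> [|v w IHw] i; first by rewrite !big_nil mul1mx mxE.
by rewrite /= !big_cons -mulmxA ME IHw.
Qed.

(** The left-hand side is the value at [0] of [f], evaluated on generic
    homogeneous elements and applied to the constant function [1]. *)
Lemma graded_identity_steps (f : gfreealg K 'Z_p) (xi : letter * 'Z_p -> K) :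
    graded_identities (weyl_grading K p) f ->
  \sum_(w <- msupp f) f@_w * \prod_(t <- steps 0 w) xi t = 0.
Proof.
move=> f_id; have [psi [psi_x psi_y]] := weyl_lift (weyl_relation_mx char_K).
pose s (v : letter) := generic_element v.1 (fun i => xi (v, i)).
have s_gr v : weyl_grading K p v.1 (s v).
  exact: generic_element_homogeneous.
have /(congr1 psi) := f_id s s_gr.
rewrite (lrmorph_comp_fsubst psi) fsubstE.
move=> /(congr1 (fun M : 'M_n => (M *m (const_mx 1 : 'cV[K]_n)) 0 0)).
rewrite raddf0 mul0mx [RHS]mxE mulmx_suml summxE => {2}<-; apply: eq_bigr => w _.
rewrite -scalemxAl mxE; congr (_ * _).
rewrite -(word_eval_steps (M := psi \o s)) // => v u i /=.
by rewrite generic_elementE.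
Qed.

Hypothesis K_infinite : infinite_set [set: K].

(** The polynomial with exponents [key w] vanishes on the infinite field, so
    its coefficients, which are the sums over the classes, are zero. *)
Lemma steps_class_sum0 (f : gfreealg K 'Z_p) :
    graded_identities (weyl_grading K p) f ->
  exists key : {fmonom letter} -> nat,
    {in msupp f &, forall u w, key u = key w -> perm_eq (steps 0 u) (steps 0 w)} /\
    forall k, \sum_(w <- msupp f | key w == k) f@_w = 0.
Proof.
move=> f_id.
pose L := flatten [seq steps 0 w | w : {fmonom letter} <- msupp f].
pose N := (\max_(w <- msupp f) size (w : seq letter)).+1.
pose key (w : {fmonom letter}) := kronecker N L (steps 0 w).
exists key; split=> [u w u_f w_f|k].
  have lt_size (v : {fmonom letter}) : v \in msupp f -> (size (steps 0 v) < N)%N.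
    by move=> v_f; rewrite ltnS size_steps (leq_bigmax_seq v).
  have sub_L (v : {fmonom letter}) : v \in msupp f -> {subset steps 0 v <= L}.
    by move=> v_f t t_v; apply/flatten_mapP; exists v.
  by apply: kronecker_perm; rewrite ?lt_size //; apply: sub_L.
pose P : {poly K} := \sum_(w <- msupp f) f@_w *: 'X^(key w).
have : P = 0.
  apply: infinite_poly_eq0 K_infinite _ => z; rewrite horner_sum.
  rewrite -[RHS](graded_identity_steps (fun t => z ^+ (N ^ index t L)) f_id).
  apply: eq_bigr => w _; rewrite hornerZ hornerXn /key /kronecker.
  by rewrite expr_sum.
move=> /(congr1 (fun Q : {poly K} => Q`_k)); rewrite coef0 coef_sum => P_k.
rewrite -[RHS]P_k big_mkcond; apply: eq_bigr => w _.
by rewrite coefZ coefXn eq_sym; case: eqP; rewrite ?mulr1 ?mulr0.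
Qed.

End GenericEvaluation.

(** Replacing each [b w] by that of one fixed member of its class changes the
    sum by an element of [I]; afterwards each class contributes its
    coefficient sum, which is [0]. *)
Lemma class_sum_closed (K : fieldType) (V : lmodType K) (I : set V)
    (T J : choiceType) (D : {fset T}) (c : T -> K) (b : T -> V) (key : T -> J) :
    I 0 -> (forall u v, I u -> I v -> I (u + v)) ->
    (forall a v, I v -> I (a *: v)) ->
    {in D &, forall u w, key u = key w -> I (b u - b w)} ->
    (forall k, \sum_(w <- D | key w == k) c w = 0) ->
  I (\sum_(w <- D) c w *: b w).
Proof.
move=> I0 ID IZ key_I key_sum.
rewrite (partition_big_imfset _ key); elim/big_ind: _ => // k _.
have [/hasP[w0 w0_D /eqP key_w0]|no_k] := boolP (has (fun w => key w == k) D).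
  have -> : \sum_(w <- D | key w == k) c w *: b w =
      \sum_(w <- D | key w == k) c w *: (b w - b w0).
    rewrite [RHS](eq_bigr (fun w => c w *: b w - c w *: b w0)) => [|w _].
      by rewrite sumrB -scaler_suml key_sum scale0r subr0.
    by rewrite scalerBr.
  rewrite big_seq_cond; elim/big_ind: _ => // w /andP[w_D /eqP key_w].
  by apply/IZ/key_I; rewrite ?key_w.
rewrite big1_seq // => w /andP[key_w w_D]; case/hasP: no_k.
by exists w.
Qed.

Lemma graded_identity_in_T_ideal (K : fieldType) (p : nat)
    (I : set (gfreealg K 'Z_p)) (f : gfreealg K 'Z_p) :
    infinite_set [set: K] -> p \in [pchar K] -> graded_T_ideal I ->
    (forall alpha : 'Z_p,
      I (gvar K alpha 1%N * gvar K (- alpha) 2%N * gvar K alpha 3%N -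
         gvar K alpha 3%N * gvar K (- alpha) 2%N * gvar K alpha 1%N)) ->
  graded_identities (weyl_grading K p) f -> I f.
Proof.
move=> K_inf char_K I_T I_triple f_id.
have [key [key_perm key_sum]] := steps_class_sum0 char_K K_inf f_id.
rewrite [f]freealg_expand; apply: class_sum_closed key_sum.
- exact: T_ideal0.
- by move=> u v; apply: T_idealD.
- by move=> a v; apply: T_idealZ.
- move=> [u] [w] u_f w_f /(key_perm _ _ u_f w_f).
  exact: perm_steps_T_ideal.
Qed.

Lemma graded_identities_weyl_T_ideal (K : fieldType) (p : nat) :
  graded_T_ideal (graded_identities (weyl_grading K p)).
Proof.
apply: graded_identities_T_ideal.
- by move=> g; apply: lspan_linear.
- by move=> g; apply: lspan0.
- exact: homogeneous_part1.
- by move=> g h a b; apply: homogeneousM; apply: weyl_yx.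
Qed.

Theorem theorem18 (K : fieldType) (p : nat)
    (K_infinite : infinite_set [set: K])
    (p_gt2 : (2 < p)%N)
    (char_K : p \in [pchar K]) :
  graded_identities (weyl_grading K p) =
  graded_T_ideal_generated
    ([set gvar K (0 : 'Z_p) 1%N * gvar K 0 2%N - gvar K 0 2%N * gvar K 0 1%N] `|`
     [set f | exists alpha : 'Z_p,
        f = gvar K alpha 1%N * gvar K (- alpha) 2%N * gvar K alpha 3%N -
            gvar K alpha 3%N * gvar K (- alpha) 2%N * gvar K alpha 1%N]).
Proof.
apply/seteqP; split=> [f f_id I [I_T genI]|].
  apply: graded_identity_in_T_ideal K_infinite char_K I_T _ f_id => alpha.
  by apply: genI; right; exists alpha.
apply: smallest_sub; first exact: graded_identities_weyl_T_ideal.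
have W_triple k a b c : weyl_grading K p k a -> weyl_grading K p (- k) b ->
    weyl_grading K p k c -> a * b * c - c * b * a = 0.
  move=> Aa Ab Ac; apply/eqP; rewrite subr_eq0; apply/eqP.
  exact: (homogeneous_triple (weyl_yx K) char_K Aa Ab Ac).
have W_commutator a b : weyl_grading K p 0 a -> weyl_grading K p 0 b ->
    a * b - b * a = 0.
  move=> Aa Ab; rewrite -{1}[a]mulr1 -{2}[b]mulr1; apply: (W_triple 0) => //.
  by rewrite oppr0; apply: homogeneous_part1.
move=> _ [->|[alpha ->]] s s_gr.
  apply: etrans (rmorph_commutator (fsubst_var _ _) (fsubst_var _ _)) _.
  exact: W_commutator (s_gr (0, 1%N)) (s_gr (0, 2%N)).
apply: etrans (rmorph_triple (fsubst_var _ _) (fsubst_var _ _) (fsubst_var _ _)) _.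
exact: W_triple (s_gr (alpha, 1%N)) (s_gr (- alpha, 2%N)) (s_gr (alpha, 3%N)).
Qed.
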